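(* Let $R$ be a ring with identity, and let $a\in R$ be quasi-quasipolar with spectral idempotent $p$ and Koliha-Drazin (generalized Drazin) inverse $b=(a+p)^{-1}(1-p)$. Then $a$ is naturally invertible, $M=1-p$ is the greatest element of $\Sigma_2(a)$ for the natural partial order, and $b=a^{\parallel M}$, i.e. $b$ is the natural generalized inverse of $a$.
   Context: Rings are associative with identity; $R^{-1}$ is the group of units. For a subset $A\subseteq R$, $A'=\{x\in R: xa=ax\ \forall a\in A\}$ is the commutant and $A''=(A')'$. $E(R)$ is the set of idempotents of $R$, with natural partial order $e\le f\iff ef=fe=e$. Green's relations are those of the multiplicative monoid $R$: $x\leq_{\mathcal L}y\iff x\in Ry$; $x\leq_{\mathcal R}y\iff x\in yR$; $x\leq_{\mathcal H}y$ iff both hold; $x\,\mathcal H\,y$ iff $x\leq_{\mathcal H}y$ and $y\leq_{\mathcal H}x$. Inverse along an element: $a$ is invertible along $d$ if there is $b$ with $bad=d=dab$ and $b\leq_{\mathcal H}d$; such $b$ is unique and denoted $a^{\parallel d}$. For an idempotent $e$, $a^{\parallel e}$ exists if and only if $eae\,\mathcal H\,e$. $\Sigma_2(a)=\{e\in E(R): eae\,\mathcal H\,e\}\cap\{a\}''$. The element $a$ is naturally invertible if $\Sigma_2(a)$ has a greatest element $M$ for the natural partial order; then $a^{\parallel M}$ is called the natural (generalized) inverse of $a$. An element $q\in R$ is quasi-quasinilpotent if $1+xq\in R^{-1}$ for all $x\in\{q\}''$. An element $a\in R$ is quasi-quasipolar if there is an idempotent $p\in\{a\}''$ (called a spectral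 idempotent of $a$) such that $ap$ is quasi-quasinilpotent and $a+p\in R^{-1}$. *)

(* Defs.v *)
From mathcomp Require Import all_boot all_algebra.

Set Implicit Arguments.
Unset Strict Implicit.
Unset Printing Implicit Defensive.

Import GRing.Theory.
Local Open Scope ring_scope.

(* Rings are [pzRingType]: associative with identity, neither commutative nor
   assumed nontrivial, and without decidable units.  Subsets of R are
   Prop-valued predicates. *)

Section RingNotions.
Variable R : pzRingType.
Implicit Types (a b d e f p q u v x y : R) (A S : R -> Prop).

Definition is_inverse u v : Prop := u * v = 1 /\ v * u = 1.

Definition invertible u : Prop := exists v, is_inverse u v.

Definition idempotent_elt e : Prop := e * e = e.

Definition commutant A : R -> Prop :=
  fun x => forall a, A a -> GRing.comm x a.

Definition bicommutant1 a : R -> Prop :=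
  commutant (commutant (fun x => x = a)).

Definition leL x y : Prop := exists r, x = r * y.

Definition leR x y : Prop := exists r, x = y * r.

Definition leH x y : Prop := leL x y /\ leR x y.

Definition relH x y : Prop := leH x y /\ leH y x.

(* The natural partial order, to be used on idempotents only. *)
Definition le_idem e f : Prop := e * f = e /\ f * e = e.

Definition greatest_idem S M : Prop := S M /\ forall e, S e -> le_idem e M.

(* [inverse_along a d b] is the graph of the partial operation sending
   (a, d) to the inverse of a along d; it is single-valued by
   [inverse_along_uniq] below. *)
Definition inverse_along a d b : Prop :=
  [/\ b * a * d = d, d * a * b = d & leH b d].

Definition Sigma2 a : R -> Prop :=
  fun e => [/\ idempotent_elt e, relH (e * a * e) e & bicommutant1 a e].

Definition naturally_invertible a : Prop :=
  exists M, greatest_idem (Sigma2 a) M.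

Definition natural_inverse a b : Prop :=
  exists M, greatest_idem (Sigma2 a) M /\ inverse_along a M b.

Definition quasi_quasinilpotent q : Prop :=
  forall x, bicommutant1 q x -> invertible (1 + x * q).

Definition spectral_idempotent a p : Prop :=
  [/\ idempotent_elt p, bicommutant1 a p,
      quasi_quasinilpotent (a * p) & invertible (a + p)].

Definition quasi_quasipolar a : Prop := exists p, spectral_idempotent a p.

(* b = (a + p)^-1 (1 - p); a two-sided inverse is unique when it exists. *)
Definition Koliha_Drazin_inverse a p b : Prop :=
  exists2 c, is_inverse (a + p) c & b = c * (1 - p).

Lemma inverse_along_uniq a d b b' :
  inverse_along a d b -> inverse_along a d b' -> b = b'.
Proof.
move=> [bad _ [[s bE] _]] [_ dab' [_ [t b'E]]].
have -> : b = b * a * b' by rewrite {1}bE -dab' !mulrA -bE.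
by rewrite {1}b'E mulrA bad -b'E.
Qed.

Lemma greatest_idem_uniq S M N :
  greatest_idem S M -> greatest_idem S N -> M = N.
Proof.
by move=> [SM leM] [SN leN]; case: (leM _ SN) (leN _ SM) => _ + [+ _] => -> ->.
Qed.

End RingNotions.

(* Main.v *)
(* Let e be in Sigma2(a) and let c be the inverse of e a in the corner ring
   e R e; it lies in {a}''.  The key point is that c p lies not only in {a}''
   but in {a p}'': if z commutes with a p, then p z p commutes with a, hence
   with c, while the off-diagonal parts (1 - p) z p and p z (1 - p) are killed
   by e on the side of p because e = a c = c a.  Quasi-quasinilpotence of a p
   then makes 1 - (c p)(a p) = 1 - e p invertible; being idempotent, it is 1,
   so e p = 0, i.e. e <= 1 - p. *)
Require Import Defs.
From mathcomp Require Import all_boot all_algebra.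
Import GRing.Theory.
Local Open Scope ring_scope.

Lemma comm_bicommutant1 {R : pzRingType} {a x z : R} :
  bicommutant1 a x -> GRing.comm z a -> x * z = z * x.
Proof. by move=> ax za; apply: ax => _ ->. Qed.

Lemma bicommutant1I {R : pzRingType} {a x : R} :
  (forall z, z * a = a * z -> x * z = z * x) -> bicommutant1 a x.
Proof. by move=> ax z za; apply/ax/za. Qed.

Lemma bicommutant1_comm {R : pzRingType} {a x : R} :
  bicommutant1 a x -> x * a = a * x.
Proof. by move=> ax; apply: comm_bicommutant1 ax _. Qed.

Lemma bicommutant1_1B {R : pzRingType} {a x : R} :
  bicommutant1 a x -> bicommutant1 a (1 - x).
Proof.
move=> ax; apply: bicommutant1I => z za.
by rewrite mulrBl mulrBr mul1r mulr1 (comm_bicommutant1 ax za).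
Qed.

Lemma idempotent_1B {R : pzRingType} {p : R} :
  idempotent_elt p -> idempotent_elt (1 - p).
Proof.
by move=> pp; rewrite /idempotent_elt mulrBl mul1r mulrBr mulr1 pp subrr subr0.
Qed.

Lemma invertible_idempotent {R : pzRingType} {e : R} :
  idempotent_elt e -> invertible e -> e = 1.
Proof. by move=> ee [v [_ ve]]; rewrite -[e]mul1r -ve -mulrA ee. Qed.

(** The relation [e * a * e] H [e] supplies [r] and [s], which give a left inverse [e * r * e] and a
    right inverse [e * s] of [e * a] in the corner of [e]; these coincide. *)
Lemma Sigma2_corner_inverse {R : pzRingType} {a e : R} :
  Sigma2 a e ->
  exists c, [/\ c * a = e, a * c = e, e * c = c, c * e = c & bicommutant1 a c].
Proof.
move=> [ee [_ [[r er] [s es]]] ae].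
have ea := bicommutant1_comm ae.
have eaeE : e * a * e = e * a by rewrite -mulrA -ea mulrA ee.
(* Both sides are values of [e * r * e * a * e * s]. *)
have rs : e * r * e = e * s.
  rewrite {2}es !mulrA.
  have -> : e * r * e * a * e * s = e * (r * (e * a * e)) * s by rewrite !mulrA.
  by rewrite -er ee.
have ca : e * r * e * a = e.
  have -> : e * r * e * a = e * (r * (e * a * e)) by rewrite eaeE !mulrA.
  by rewrite -er ee.
have ac : a * (e * r * e) = e.
  by rewrite rs mulrA -ea -eaeE -es.
exists (e * r * e).
have ec : e * (e * r * e) = e * r * e by rewrite !mulrA ee.
have ce : e * r * e * e = e * r * e by rewrite -mulrA ee.
split=> //.
move: (e * r * e) ca ac ec ce => c ca ac ec ce.
apply: bicommutant1I => z za.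
have ez := comm_bicommutant1 ae za.
(* The chain is [z c = e z c = c a z c = c z a c = c z e = c e z = c z]. *)
rewrite -{2}ec mulrA -ez -{1}ca -!mulrA (mulrA a z) -za -mulrA ac -ez.
by rewrite mulrA ce.
Qed.

Lemma Sigma2_mul_spectral {R : pzRingType} {a p e : R} :
  spectral_idempotent a p -> Sigma2 a e -> e * p = 0.
Proof.
move=> [pp ap qn _] Se; have [ee _ ae] := Se.
have [c [ca ac ec ce acc]] := Sigma2_corner_inverse Se.
have pa := bicommutant1_comm ap.
have cp := comm_bicommutant1 acc pa.
have ep := comm_bicommutant1 ae pa.
have cpq : bicommutant1 (a * p) (c * p).
  apply: bicommutant1I => z zq.
  (* Both sides collapse to [a * p * z], by moving [a * p] across [z]. *)
  have pzpa : p * z * p * a = a * (p * z * p).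
    transitivity (a * p * z).
      by rewrite -mulrA pa -mulrA zq !mulrA pa -(mulrA a) pp.
    by rewrite !mulrA -zq -!mulrA pp.
  have cpzp := comm_bicommutant1 acc pzpa.
  (* Writing [e = a * c] turns [z * p * e] into [a * p * z * c], which [p] fixes on the left; [epz]
     is the mirror image, using [e = c * a]. *)
  have zpe : z * p * e = p * z * p * e.
    have zpeE : z * p * e = a * p * z * c.
      by rewrite -ac !mulrA -(mulrA z) pa zq.
    have -> : p * z * p * e = p * (z * p * e) by rewrite !mulrA.
    by rewrite zpeE !mulrA pa -(mulrA a p p) pp.
  have epz : e * p * z = e * p * z * p.
    by rewrite -ca -!(mulrA c) -zq -!mulrA pp.
  have -> : z * (c * p) = z * p * e * c by rewrite cp mulrA -(mulrA _ e) ec.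
  have -> : c * p * z = c * (e * p * z) by rewrite !mulrA ce.
  by rewrite epz zpe -(mulrA _ e) ec -cpzp !mulrA ce.
have Ncpq : bicommutant1 (a * p) (- (c * p)).
  apply: bicommutant1I => z zq.
  by rewrite mulNr mulrN (comm_bicommutant1 cpq zq).
have epep : idempotent_elt (e * p).
  by rewrite /idempotent_elt {2}ep mulrA -(mulrA e p) pp -mulrA -ep mulrA ee.
have := qn _ Ncpq.
have -> : 1 + - (c * p) * (a * p) = 1 - e * p.
  by rewrite mulNr -mulrA (mulrA p a) pa -mulrA pp mulrA ca.
move=> /(invertible_idempotent (idempotent_1B epep)) /eqP.
by rewrite -subr_eq0 addrAC subrr add0r oppr_eq0 => /eqP.
Qed.

Theorem theorem4p10 (R : pzRingType) (a p b : R)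
    (a_qqpolar : quasi_quasipolar a)
    (p_spectral : spectral_idempotent a p)
    (b_KD : Koliha_Drazin_inverse a p b) :
  [/\ naturally_invertible a,
      greatest_idem (Sigma2 a) (1 - p),
      inverse_along a (1 - p) b
    & natural_inverse a b].
Proof.
have [pp ap _ _] := p_spectral.
have [c [apc cap] bE] := b_KD.
set M := 1 - p in bE *.
have MM : M * M = M by apply: idempotent_1B.
have aM : bicommutant1 a M by apply: bicommutant1_1B.
have Ma := bicommutant1_comm aM.
have pM : p * M = 0 by rewrite mulrBr mulr1 pp subrr.
have Mp : M * p = 0 by rewrite mulrBl mul1r pp subrr.
(* Since [p] vanishes against [M], [a + p] acts as [a] there, so its inverse [c] inverts [a] on the
   corner of [M]. *)
have aME : (a + p) * M = a * M by rewrite mulrDl pM addr0.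
have MaE : M * (a + p) = M * a by rewrite mulrDr Mp addr0.
have caM : c * (a * M) = M by rewrite -aME mulrA cap mul1r.
have Mac : M * a * c = M by rewrite -MaE -mulrA apc mulr1.
have cM : c * M = M * c.
  by rewrite -{1}Mac Ma !mulrA -(mulrA c) caM.
have MaM : M * a * M = a * M by rewrite Ma -mulrA MM.
have inv : inverse_along a M b.
  rewrite bE; split.
  - by rewrite -!mulrA (mulrA M) MaM caM.
  - by rewrite cM mulrA MaM -Ma Mac.
  - by split; exists c.
have greatest : greatest_idem (Sigma2 a) M.
  split.
    split=> //; rewrite MaM; split.
      by split; exists a; rewrite // Ma.
    by split; exists c; rewrite ?caM // -Ma Mac.
  (* From [e * p = 0], commutation of [e] with [p] also gives [p * e = 0], hence both halves of the
     order. *)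
  move=> e Se; have eM := Sigma2_mul_spectral p_spectral Se.
  have [_ _ ae] := Se.
  have ep := comm_bicommutant1 ae (bicommutant1_comm ap).
  by split; rewrite ?mulrBr ?mulrBl ?mulr1 ?mul1r -?ep eM subr0.
by split=> //; exists M.
Qed.
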